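(* Let $p\equiv 3\pmod 4$ be prime and let $r\ge 1$ be an integer. Then, in $\mathbb Z[i]$, $$\mathbf G_{r(p-1)}(p)\equiv 1+(-1)^r-(p+1)\mathbf 1_{p+1\mid r}\pmod p,$$ where $\mathbf 1_{p+1\mid r}$ is $1$ if $p+1\mid r$ and $0$ otherwise. Equivalently, $$\mathbf G_{r(p-1)}(p)\equiv\begin{cases}0\pmod p,& r\text{ odd},\\ 2\pmod p,& r\text{ even and }p+1\nmid r,\\ 1\pmod p,& p+1\mid r.\end{cases}$$ If $p\ge 7$, then $v_p(\mathbf G_{r(p-1)}(p))=0$ if $r$ is even, whereas $v_p(\mathbf G_{r(p-1)}(p))\ge 3$ if $r$ is odd. Consequently, for every positive multiple $n$ of $p-1$, $$v_p(\mathbf G_n(p))=0\iff \operatorname{lcm}(4,p-1)\mid n.$$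
   Context: Here $i^2=-1$. For an odd prime $p$ and $n\ge 0$, $\mathbf G_n(p)=\sum_{a=1}^{p-1}\sum_{b=1}^{p-1}(a+bi)^n\in\mathbb Z[i]$. For $x+yi\in\mathbb Z[i]$, $v_p(x+yi)=\min\{v_p(x),v_p(y)\}$, where $v_p$ on integers is the usual $p$-adic valuation ($v_p(0)=\infty$). *)

(* Defs.v *)
From HB Require Import structures.
From mathcomp Require Import all_boot all_order all_algebra.
From mathcomp Require Import constructive_ereal.
From mathcomp Require Import ring.

Set Implicit Arguments.
Unset Strict Implicit.
Unset Printing Implicit Defensive.

Import Order.TTheory GRing.Theory Num.Theory.
Local Open Scope ring_scope.

(* The ring Z[i]: [GaussInt x y] is x + y i. A separate record is used because
   the ring structure of mathcomp's [complex R] requires R to be a field. *)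
Record gaussInt := GaussInt { gaussRe : int; gaussIm : int }.

Definition pair_of_gaussInt (z : gaussInt) := (gaussRe z, gaussIm z).
Definition gaussInt_of_pair (u : int * int) := GaussInt u.1 u.2.

Lemma pair_of_gaussIntK : cancel pair_of_gaussInt gaussInt_of_pair.
Proof. by case. Qed.

HB.instance Definition _ := Countable.copy gaussInt (can_type pair_of_gaussIntK).

Definition gauss_add (z w : gaussInt) :=
  GaussInt (gaussRe z + gaussRe w) (gaussIm z + gaussIm w).
Definition gauss_opp (z : gaussInt) := GaussInt (- gaussRe z) (- gaussIm z).
Definition gauss_mul (z w : gaussInt) :=
  GaussInt (gaussRe z * gaussRe w - gaussIm z * gaussIm w)
           (gaussRe z * gaussIm w + gaussIm z * gaussRe w).

Lemma gauss_addA : associative gauss_add.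
Proof. by move=> [a b] [c d] [e f]; congr GaussInt => /=; ring. Qed.
Lemma gauss_addC : commutative gauss_add.
Proof. by move=> [a b] [c d]; congr GaussInt => /=; ring. Qed.
Lemma gauss_add0 : left_id (GaussInt 0 0) gauss_add.
Proof. by move=> [a b]; congr GaussInt => /=; ring. Qed.
Lemma gauss_addN : left_inverse (GaussInt 0 0) gauss_opp gauss_add.
Proof. by move=> [a b]; congr GaussInt => /=; ring. Qed.

HB.instance Definition _ := GRing.isZmodule.Build gaussInt
  gauss_addA gauss_addC gauss_add0 gauss_addN.

Lemma gauss_mulA : associative gauss_mul.
Proof. by move=> [a b] [c d] [e f]; congr GaussInt => /=; ring. Qed.
Lemma gauss_mulC : commutative gauss_mul.
Proof. by move=> [a b] [c d]; congr GaussInt => /=; ring. Qed.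
Lemma gauss_mul1 : left_id (GaussInt 1 0) gauss_mul.
Proof. by move=> [a b]; congr GaussInt => /=; ring. Qed.
Lemma gauss_mulDl : left_distributive gauss_mul +%R.
Proof. by move=> [a b] [c d] [e f]; congr GaussInt => /=; ring. Qed.
Lemma gauss_oner_neq0 : GaussInt 1 0 != 0.
Proof. by []. Qed.

HB.instance Definition _ := GRing.Zmodule_isComNzRing.Build gaussInt
  gauss_mulA gauss_mulC gauss_mul1 gauss_mulDl gauss_oner_neq0.

Definition gaussI : gaussInt := GaussInt 0 1.

Lemma sqr_gaussI : gaussI ^+ 2 = -1.
Proof. by []. Qed.

Definition congr_mod (R : comNzRingType) (m x y : R) : Prop :=
  exists q : R, x - y = q * m.

Definition gauss_power_sum (p n : nat) : gaussInt :=
  \sum_(1 <= a < p) \sum_(1 <= b < p) (a%:R + b%:R * gaussI) ^+ n.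

(* [logn p 0 = 0], so the value +oo at 0 has to be imposed. *)
Definition padic_val (p : nat) (x : int) : \bar int :=
  if x == 0 then +oo%E else (logn p `|x|%N)%:Z%:E.

Definition gauss_val (p : nat) (z : gaussInt) : \bar int :=
  Order.min (padic_val p (gaussRe z)) (padic_val p (gaussIm z)).

(* Main.v *)
Require Import Defs.
From HB Require Import structures.
From mathcomp Require Import all_boot all_order all_algebra.
From mathcomp Require Import constructive_ereal.
From mathcomp Require Import cyclic finfield.
From mathcomp Require Import zify ring.

Set Implicit Arguments.
Unset Strict Implicit.
Unset Printing Implicit Defensive.

Import Order.TTheory GRing.Theory Num.Theory.
Local Open Scope ring_scope.

(** The sum is first computed modulo p.  As p = 3 mod 4, the ring Z[i]/p is the
field F with p^2 elements: [gauss_eval] maps i to a square root j of -1 in F,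
and by [gauss_congrP] two Gaussian integers have the same image exactly when
they are congruent modulo p.  The square 1 <= a, b < p is sent to F without the
lines a = 0 and b = 0.  Over all of F the n-th powers sum to -1 or 0, according
as p^2 - 1 divides n or not ([sum_expf]); each of the two lines contributes a
power sum over the prime field, which is -1 or 0 according as p - 1 divides n or
not, and the line a = 0 carries an additional factor j^n.  For n = r(p-1) the condition
p^2 - 1 | n becomes p + 1 | r, and j^n = (-1)^r because (p-1)/2 is odd; this is
[gauss_power_sum_congr].

For odd r, divisibility by p^3 comes from two symmetries of the square.  Write
G_n for the sum and z for its running point a + bi, and put m = n - 2.
The point reflection sends z to p(1+i) - z; expanding the odd power m+1 gives
  2 G_(m+1) = (m+1) p (1+i) G_m   modulo p^2,
and the quarter turn about the centre sends z to i(z - pi); since i^n = -1,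
expanding the n-th power gives, for some constant c,
  2 G_n = n p i G_(n-1) + c p^2 G_(n-2)   modulo p^3.
So if p divides G_(n-2), then p^2 divides G_(n-1) and p^3 divides G_n
([square_power_sum_cube]).  Finally p does divide G_(n-2) by the computation in
F, because p - 1 cannot divide n - 2 when p > 3.

The statements about valuations follow: for even r the sum is 1 or 2 modulo p,
hence prime to p, and with (p-1)/2 odd, lcm(4, p-1) | r(p-1) means that r is
even. *)

(** * Power sums over finite fields *)

Lemma finField_prim_root (F : finFieldType) :
  exists g : F, (#|F|.-1).-primitive_root g.
Proof.
have qP : (1 < #|F|)%N by apply: finNzRing_gt1.
have /hasP[g _ gP] : has (#|F|.-1).-primitive_root (enum [pred x : F | x != 0]).
  apply: has_prim_root; rewrite ?enum_uniq //; first by lia.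
    apply/allP => x; rewrite mem_enum inE => x0.
    rewrite unity_rootE; apply/eqP/(mulfI x0); rewrite -exprS mulr1.
    by rewrite prednK ?expf_card //; lia.
  by rewrite -cardE cardC1.
by exists g.
Qed.

(** Translation by 1 permutes F, so the sum of all elements of F absorbs one 1 for
each element. *)
Lemma finField_natr_card (F : finFieldType) : #|F|%:R = 0 :> F.
Proof.
have /eqP : \sum_(x : F) x = \sum_(x : F) (x + 1).
  by rewrite (reindex_inj (addIr 1)).
by rewrite big_split /= sumr_const -subr_eq0 opprD addNKr oppr_eq0 => /eqP.
Qed.

(** Multiplication by a generator g of the unit group permutes F, so the sum is
fixed by multiplication by g^n and vanishes unless g^n = 1. *)
Lemma sum_expf (F : finFieldType) (n : nat) : (0 < n)%N ->
  \sum_(x : F) x ^+ n = - (#|F|.-1 %| n)%N%:R.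
Proof.
move=> n0; have [g gP] := finField_prim_root F.
have q0 := prim_order_gt0 gP.
have qK : #|F|.-1.+1 = #|F| by rewrite prednK // (leq_trans q0) // leq_pred.
case: (boolP (_ %| n)%N) => [/dvdnP[k nE] | ndvd].
  rewrite (bigD1 0) //= expr0n gtn_eqF // add0r.
  rewrite (eq_bigr (fun=> 1)) => [|x x0].
    rewrite sumr_const cardC1; apply/eqP; rewrite -addr_eq0 -natrD addn1.
    by rewrite qK finField_natr_card.
  have x1 : x ^+ #|F|.-1 = 1.
    by apply: (mulfI x0); rewrite -exprS mulr1 qK expf_card.
  by rewrite nE mulnC exprM x1 expr1n.
have g0 : g != 0.
  apply/eqP => gE; have := prim_expr_order gP.
  by rewrite gE expr0n gtn_eqF // => /esym/eqP; rewrite oner_eq0.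
have : \sum_(x : F) x ^+ n = g ^+ n * \sum_(x : F) x ^+ n.
  rewrite mulr_sumr {1}(reindex_inj (mulfI g0)).
  by apply: eq_bigr => x _; rewrite exprMn.
move/eqP; rewrite -subr_eq0 -{1}[X in X - _]mul1r -mulrBl mulf_eq0 subr_eq0.
rewrite [1 == _]eq_sym -(prim_order_dvd gP) (negbTE ndvd) /= => /eqP ->.
by rewrite oppr0.
Qed.

(** The terms live in the prime field; the sum over 'F_p is transferred to R as a
divisibility in nat. *)
Lemma sum_exp_pchar (R : nzRingType) (p n : nat) : p \in [pchar R] -> (0 < n)%N ->
  \sum_(1 <= a < p) a%:R ^+ n = - (p.-1 %| n)%N%:R :> R.
Proof.
move=> pR n0; have p_pr : prime p by case/andP: pR.
(* N is kept apart from p, on which the type 'F_p depends. *)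
have Fp_sum N : N = (Zp_trunc (pdiv p)).+2 ->
    \sum_(0 <= i < N) i%:R ^+ n = \sum_(x : 'F_p) x ^+ n.
  by move=> ->; rewrite big_mkord; apply: eq_bigr => i _; rewrite natr_Zp.
have := Fp_sum p (esym (Fp_cast p_pr)); rewrite sum_expf // card_Fp //.
rewrite big_ltn ?prime_gt0 // expr0n gtn_eqF // add0r => /eqP.
rewrite -subr_eq0 opprK => E.
have {E} : (p %| \sum_(1 <= a < p) a ^ n + (p.-1 %| n))%N.
  rewrite (dvdn_pcharf (pchar_Fp p_pr)) natrD natr_sum.
  by under eq_bigr do rewrite natrX.
rewrite (dvdn_pcharf pR) natrD natr_sum addr_eq0 => /eqP <-.
by under [RHS]eq_bigr do rewrite natrX.
Qed.

(** * Congruences in a commutative ring *)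

Lemma congr_mod0P (R : comNzRingType) (m x y : R) :
  congr_mod m x y <-> congr_mod m (x - y) 0.
Proof. by rewrite /congr_mod subr0. Qed.

Lemma congr_mod_trans (R : comNzRingType) (m x y z : R) :
  congr_mod m x y -> congr_mod m y z -> congr_mod m x z.
Proof. by move=> [q qE] [s sE]; exists (q + s); rewrite mulrDl -qE -sE; ring. Qed.

Lemma congr_mod_sum (R : comNzRingType) (m : R) (a b : nat) (f g : nat -> R) :
  (forall i, (a <= i < b)%N -> congr_mod m (f i) (g i)) ->
  congr_mod m (\sum_(a <= i < b) f i) (\sum_(a <= i < b) g i).
Proof.
move=> fg; rewrite big_nat [X in congr_mod _ _ X]big_nat.
apply: (big_ind2 (congr_mod m)) => //; first by exists 0; rewrite subrr mul0r.
by move=> x1 x2 y1 y2 [q qE] [s sE]; exists (q + s); rewrite mulrDl -qE -sE; ring.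
Qed.

Lemma congr_mod_mulr (R : comNzRingType) (m d x y : R) :
  congr_mod (m * d) x y -> congr_mod m x y.
Proof. by move=> [q qE]; exists (q * d); rewrite qE; ring. Qed.

(** Bezout: 1 = m - 2 (m - 1)/2 for odd m. *)
Lemma congr_mod_half (R : comNzRingType) (m : nat) (x : R) :
  odd m -> congr_mod m%:R (x + x) 0 -> congr_mod m%:R x 0.
Proof.
move=> m_odd [q]; rewrite subr0 => qE; exists (x - (m./2)%:R * q).
rewrite subr0 mulrBl -mulrA -qE.
have -> : m%:R = 1 + 2%:R * m./2%:R :> R.
  by rewrite -{1}[m]odd_double_half m_odd -mul2n natrD natrM.
by ring.
Qed.

(** * Reduction of Z[i] modulo p *)

(** The proof that j^2 = -1 is an argument so that the ring morphism structure can
be attached to this function. *)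
Definition gauss_eval (R : comNzRingType) (j : R) (j2 : j ^+ 2 = -1) (z : gaussInt) : R :=
  (gaussRe z)%:~R + (gaussIm z)%:~R * j.

Lemma gauss_eval_is_zmod_morphism R j j2 : zmod_morphism (@gauss_eval R j j2).
Proof. by case=> [a b] [c d]; rewrite /gauss_eval /= !rmorphD !rmorphN /=; ring. Qed.

Lemma gauss_eval_is_monoid_morphism R j j2 : monoid_morphism (@gauss_eval R j j2).
Proof.
split; first by rewrite /gauss_eval /= mul0r addr0.
case=> [a b] [c d]; rewrite /gauss_eval /= !rmorphD !rmorphN !rmorphM /=.
have -> : a%:~R * c%:~R - b%:~R * d%:~R = a%:~R * c%:~R + b%:~R * d%:~R * j ^+ 2 :> R.
  by rewrite j2; ring.
ring.
Qed.

HB.instance Definition _ (R : comNzRingType) (j : R) (j2 : j ^+ 2 = -1) :=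
  GRing.isZmodMorphism.Build gaussInt R (gauss_eval j2) (gauss_eval_is_zmod_morphism j2).
HB.instance Definition _ (R : comNzRingType) (j : R) (j2 : j ^+ 2 = -1) :=
  GRing.isMonoidMorphism.Build gaussInt R (gauss_eval j2) (gauss_eval_is_monoid_morphism j2).

Lemma gauss_natr n : n%:R = GaussInt n%:Z 0.
Proof. by elim: n => // n IH; rewrite -addn1 natrD IH; congr GaussInt; rewrite PoszD. Qed.

Lemma gauss_mulrn (x y : int) (m : nat) :
  GaussInt x y * m%:R = GaussInt (x * m%:Z) (y * m%:Z).
Proof. by rewrite gauss_natr; congr GaussInt => /=; ring. Qed.

Lemma gauss_congr0P (m : nat) (z : gaussInt) :
  congr_mod m%:R z 0 <-> (m%:Z %| gaussRe z)%Z /\ (m%:Z %| gaussIm z)%Z.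
Proof.
case: z => a b /=; split=> [[[x y]] | [/dvdzP[x ->] /dvdzP[y ->]]].
  by rewrite subr0 gauss_mulrn => -[-> ->]; rewrite !dvdz_mull.
by exists (GaussInt x y); rewrite subr0 gauss_mulrn.
Qed.

(** For the converse the Frobenius map is applied to x + y j = 0: it fixes x and y,
and sends j to -j because p = 3 mod 4.  Hence x - y j = 0 as well, and both x
and y vanish in F, where 2 and j are units. *)
Lemma gauss_congrP (F : fieldType) (j : F) (j2 : j ^+ 2 = -1) (p : nat) (z w : gaussInt) :
  p \in [pchar F] -> (p = 3 %[mod 4])%N ->
  congr_mod p%:R z w <-> gauss_eval j2 z = gauss_eval j2 w.
Proof.
move=> pF p3; split=> [[q qE]|].
  by apply/eqP; rewrite -subr_eq0 -rmorphB qE rmorphM rmorph_nat (pcharf0 pF) mulr0.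
move=> /eqP; rewrite -subr_eq0 -rmorphB => /eqP E; apply/congr_mod0P/gauss_congr0P.
case: (z - w) E => x y; rewrite /= /gauss_eval /= => E.
have j0 : j != 0 by rewrite -sqrf_eq0 j2 oppr_eq0 oner_neq0.
have jp : j ^+ p = - j.
  rewrite (divn_eq p 4) p3 exprD mulnC exprM.
  have -> : j ^+ 4 = 1 by rewrite (exprM j 2 2) j2 sqrrN expr1n.
  by rewrite expr1n mul1r exprS j2 mulrN1.
have E' : x%:~R - y%:~R * j = 0.
  have := congr1 (pFrobenius_aut pF) E.
  by rewrite rmorphD rmorphM rmorph0 /= !pFrobenius_aut_int pFrobenius_autE jp mulrN.
have two0 : (2%:R : F) != 0.
  rewrite -(dvdn_pcharf pF); apply/negP => /dvdnP[k].
  by case: k => [|[|[|k]]] kE; lia.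
have x0 : x%:~R == 0 :> F.
  have : 2%:R * x%:~R == 0 :> F.
    have -> : 2%:R * x%:~R = (x%:~R + y%:~R * j) + (x%:~R - y%:~R * j) by ring.
    by rewrite E E' addr0.
  by rewrite mulf_eq0 (negbTE two0).
have y0 : y%:~R == 0 :> F.
  by move: E; rewrite (eqP x0) add0r => /eqP; rewrite mulf_eq0 (negbTE j0) orbF.
by split; rewrite (dvdz_pcharf pF).
Qed.

(** By counting, every element of F is a + b j for exactly one pair 0 <= a, b < p.
The sum over F is therefore the wanted one plus the lines a = 0 and b = 0. *)
Lemma gauss_eval_power_sum (F : finFieldType) (j : F) (j2 : j ^+ 2 = -1)
    (p n : nat) : p \in [pchar F] -> (p = 3 %[mod 4])%N -> #|F| = (p ^ 2)%N ->
  (0 < n)%N ->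
  gauss_eval j2 (gauss_power_sum p n) =
    (1 + j ^+ n) * (p.-1 %| n)%N%:R - ((p ^ 2).-1 %| n)%N%:R.
Proof.
move=> pF p3 cardF n0; have p0 : (0 < p)%N by case: p p3 {pF cardF}.
pose h (u : 'I_p * 'I_p) : F := u.1%:R + u.2%:R * j.
have h_inj : injective h.
  move=> [a b] [c d] /=.
  have hE (u v : 'I_p) : h (u, v) = gauss_eval j2 (GaussInt (u : nat)%:Z (v : nat)%:Z) by [].
  rewrite !hE => /(gauss_congrP j2 _ _ pF p3) /congr_mod0P /gauss_congr0P [/= ac bd].
  have I_eq (u v : 'I_p) : (p %| u%:Z - v%:Z)%Z -> u = v.
    rewrite -eqz_mod_dvd => /eqP; rewrite !modz_nat !modn_small // => -[] /val_inj //.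
  by rewrite (I_eq a c ac) (I_eq b d bd).
have [h' hK h'K] : bijective h.
  by apply: inj_card_bij h_inj _; rewrite cardF card_prod card_ord expnS expn1.
have SF : \sum_(x : F) x ^+ n = \sum_(0 <= a < p) \sum_(0 <= b < p) (a%:R + b%:R * j) ^+ n.
  rewrite (reindex h) /=; last by exists h' => x _.
  rewrite big_mkord; under [RHS]eq_bigr do rewrite big_mkord.
  by rewrite pair_bigA.
have GE : gauss_eval j2 (gauss_power_sum p n) =
    \sum_(1 <= a < p) \sum_(1 <= b < p) (a%:R + b%:R * j) ^+ n.
  rewrite rmorph_sum; apply: eq_bigr => a _; rewrite rmorph_sum.
  apply: eq_bigr => b _; rewrite rmorphXn rmorphD rmorphM !rmorph_nat.
  by rewrite /= /gauss_eval /= add0r mul1r.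
(* The corner f 0 0 will be 0^n, which vanishes because n > 0. *)
have split_axes (f : nat -> nat -> F) : \sum_(0 <= a < p) \sum_(0 <= b < p) f a b =
    f 0 0 + \sum_(1 <= b < p) f 0 b + \sum_(1 <= a < p) f a 0 +
    \sum_(1 <= a < p) \sum_(1 <= b < p) f a b.
  rewrite big_ltn // [X in X + _]big_ltn // -!addrA; do 2 congr (_ + _).
  by rewrite -big_split; apply: eq_bigr => a _; rewrite big_ltn.
move: SF; rewrite split_axes -GE sum_expf // cardF.
under [X in _ + _ + X + _]eq_bigr do rewrite mul0r addr0.
under [X in _ + X + _ + _]eq_bigr do rewrite add0r exprMn.
rewrite -mulr_suml !(sum_exp_pchar pF n0) mul0r addr0 expr0n gtn_eqF // add0r => ->.
ring.
Qed.

(** The unit group is cyclic of order p^2 - 1, a multiple of 4, so it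
contains an element j of order exactly 4. *)
Lemma finField_p2 (p : nat) : prime p -> odd p ->
  exists (F : finFieldType) (j : F), [/\ p \in [pchar F], #|F| = (p ^ 2)%N & j ^+ 2 = -1].
Proof.
move=> p_pr p_odd; have [F pF cF] := pPrimePowerField p_pr (isT : 0 < 2)%N.
have [g gP] := finField_prim_root F; rewrite cF in gP.
have d4 : (4 %| (p ^ 2).-1)%N.
  have := odd_double_half p; rewrite p_odd -muln2 add1n => <-.
  by apply/dvdnP; exists (p./2 * p./2.+1)%N; rewrite -mulnn; lia.
pose j := g ^+ ((p ^ 2).-1 %/ 4); have jP : 4.-primitive_root j := dvdn_prim_root gP d4.
exists F, j; split=> //.
have /eqP : (j ^+ 2) ^+ 2 = 1 by rewrite -exprM (prim_expr_order jP).
by rewrite sqrf_eq1 -(prim_order_dvd jP) => /eqP.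
Qed.

(** * Two symmetries of the square of lattice points *)

Lemma exprD_mod2 (R : comNzRingType) (m : nat) (x y : R) :
  congr_mod (y ^+ 2) ((x + y) ^+ m.+1) (x ^+ m.+1 + m.+1%:R * x ^+ m * y).
Proof.
elim: m => [|m [q qE]]; first by exists 0; ring.
exists ((x + y) * q + m.+1%:R * x ^+ m).
have {qE} E : (x + y) ^+ m.+1 = x ^+ m.+1 + m.+1%:R * x ^+ m * y + q * y ^+ 2.
  by rewrite -qE [RHS]addrC subrK.
by rewrite exprS E -[m.+2%:R]natr1 !exprS expr0; ring.
Qed.

(** The coefficient c is binomial, but all that matters is that it does not depend
on x and y, so that it can be taken out of a sum over many x. *)
Lemma exprD_mod3 (R : comNzRingType) (m : nat) : exists c : R, forall x y : R,
  congr_mod (y ^+ 3) ((x + y) ^+ m.+2)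
    (x ^+ m.+2 + m.+2%:R * x ^+ m.+1 * y + c * x ^+ m * y ^+ 2).
Proof.
elim: m => [|m [c IH]].
  by exists 1 => x y; exists 0; ring.
exists (c + m.+2%:R) => x y; have [q qE] := IH x y.
exists ((x + y) * q + c * x ^+ m).
rewrite exprS; have -> : (x + y) ^+ m.+2 =
    x ^+ m.+2 + m.+2%:R * x ^+ m.+1 * y + c * x ^+ m * y ^+ 2 + q * y ^+ 3.
  by rewrite -qE; ring.
by rewrite -[m.+3%:R]natr1 !exprS expr0; ring.
Qed.

(** At gaussI this is [gauss_power_sum].  The symmetries below hold over any
commutative ring: only j^2 = -1 matters, not the description of Z[i] by pairs. *)
Definition square_power_sum (R : comNzRingType) (j : R) (p n : nat) : R :=
  \sum_(1 <= a < p) \sum_(1 <= b < p) (a%:R + b%:R * j) ^+ n.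

(** The terms are expanded at -z with increment p(1+j), through the substitution
(a, b) -> (p - a, p - b). *)
Lemma square_power_sum_point_reflection (R : comNzRingType) (j : R) (p k : nat) :
  ~~ odd k ->
  congr_mod (p%:R ^+ 2) (square_power_sum j p k.+1)
    (- square_power_sum j p k.+1
     + k.+1%:R * (p%:R * (1 + j)) * square_power_sum j p k).
Proof.
move=> k_even; set y := p%:R * _.
have -> : - square_power_sum j p k.+1 + k.+1%:R * y * square_power_sum j p k =
    \sum_(1 <= a < p) \sum_(1 <= b < p)
      (- (a%:R + b%:R * j) ^+ k.+1 +
       k.+1%:R * y * (a%:R + b%:R * j) ^+ k).
  rewrite /square_power_sum mulr_sumr -sumrN -big_split; apply: eq_bigr => a _.
  by rewrite mulr_sumr -sumrN -big_split.
rewrite {1}/square_power_sum big_nat_rev; apply: congr_mod_sum => a /andP[a0 ap].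
rewrite big_nat_rev; apply: congr_mod_sum => b /andP[b0 bp].
rewrite !add1n !subSS !natrB 1?ltnW //.
set x := a%:R + b%:R * j.
have -> : p%:R - a%:R + (p%:R - b%:R) * j = - x + y by rewrite /x /y; ring.
apply: (@congr_mod_mulr _ _ ((1 + j) ^+ 2)).
have xk : (- x) ^+ k = x ^+ k by rewrite exprNn -signr_odd (negbTE k_even) mul1r.
have [q] := exprD_mod2 k (- x) y; rewrite -exprMn -/y => qE; exists q.
by rewrite -qE !exprS xk; ring.
Qed.

(** The substitution (a, b) -> (p - b, a) turns z into j(z - pj), and j^(m+2) = -1. *)
Lemma square_power_sum_quarter_turn (R : comNzRingType) (j : R) (p m : nat) :
  j ^+ 2 = -1 -> (m = 0 %[mod 4])%N ->
  exists c : R,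
  congr_mod (p%:R ^+ 3) (square_power_sum j p m.+2)
    (- square_power_sum j p m.+2
     + m.+2%:R * (p%:R * j) * square_power_sum j p m.+1
     + c * p%:R ^+ 2 * square_power_sum j p m).
Proof.
move=> j2 m4; have [c cP] := exprD_mod3 R m; exists c.
set y := p%:R * j.
have -> : - square_power_sum j p m.+2 + m.+2%:R * y * square_power_sum j p m.+1
     + c * p%:R ^+ 2 * square_power_sum j p m =
    \sum_(1 <= a < p) \sum_(1 <= b < p)
      (- (a%:R + b%:R * j) ^+ m.+2 +
       m.+2%:R * y * (a%:R + b%:R * j) ^+ m.+1 +
       c * p%:R ^+ 2 * (a%:R + b%:R * j) ^+ m).
  rewrite /square_power_sum !mulr_sumr -sumrN -!big_split; apply: eq_bigr => a _.
  by rewrite !mulr_sumr -sumrN -!big_split.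
have jm2 : j ^+ m.+2 = -1.
  have /dvdnP[l ->] : (4 %| m)%N by rewrite /dvdn m4.
  have j4 : j ^+ 4 = 1 by rewrite (exprM j 2 2) j2 sqrrN expr1n.
  by rewrite -addn2 exprD mulnC exprM j4 expr1n j2 mul1r.
rewrite {1}/square_power_sum exchange_big_nat /=.
apply: congr_mod_sum => a _; rewrite big_nat_rev.
apply: congr_mod_sum => b /andP[b0 bp].
rewrite add1n subSS natrB 1?ltnW //.
set x := a%:R + b%:R * j.
have -> : p%:R - b%:R + a%:R * j = j * (x - y).
  have -> : j * (x - y) = a%:R * j + (b%:R - p%:R) * j ^+ 2.
    by rewrite /x /y; ring.
  by rewrite j2; ring.
rewrite exprMn jm2; have [q] := cP x (- y).
have -> : (- y) ^+ 2 = - p%:R ^+ 2 by rewrite sqrrN exprMn j2 mulrN1.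
have -> : (- y) ^+ 3 = p%:R ^+ 3 * j.
  have -> : (- y) ^+ 3 = - (p%:R ^+ 3 * j * j ^+ 2) by rewrite /y; ring.
  by rewrite j2; ring.
move=> qE; exists (- q * j).
have -> : - q * j * p%:R ^+ 3 = - (q * (p%:R ^+ 3 * j)) by ring.
by rewrite -qE; ring.
Qed.

(** Each symmetry gains a factor p: the point reflection gives p^2 | G_(m+1), and
then every term in the quarter-turn relation is divisible by p^3. *)
Lemma square_power_sum_cube (R : comNzRingType) (j : R) (p m : nat) :
  j ^+ 2 = -1 -> odd p -> (m = 0 %[mod 4])%N ->
  congr_mod p%:R (square_power_sum j p m) 0 ->
  congr_mod (p ^ 3)%N%:R (square_power_sum j p m.+2) 0.
Proof.
move=> j2 p_odd m4 [u]; rewrite subr0 => uE.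
have m_even : ~~ odd m by apply/negP => mo; have := odd_double_half m; lia.
have [v] : congr_mod (p ^ 2)%N%:R (square_power_sum j p m.+1) 0.
  apply: congr_mod_half; first by rewrite oddX p_odd orbT.
  have [q qE] := square_power_sum_point_reflection j p m_even.
  exists (q + m.+1%:R * (1 + j) * u); rewrite natrX mulrDl -qE uE.
  by ring.
rewrite subr0 natrX => vE.
apply: congr_mod_half; first by rewrite oddX p_odd orbT.
have [c [q qE]] := square_power_sum_quarter_turn p j2 m4.
exists (q + m.+2%:R * j * v + c * u); rewrite natrX 2!(mulrDl _ _ (p%:R ^+ 3)) -qE uE vE.
by ring.
Qed.

(** * Valuations *)

Lemma le_padic_val (p k : nat) (x : int) : prime p ->
  (k%:Z%:E <= padic_val p x)%E = ((p ^ k)%N%:Z %| x)%Z.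
Proof.
move=> p_pr; rewrite /padic_val; case: eqVneq => [->|x0]; first by rewrite dvdz0 leey.
by rewrite lee_fin lez_nat dvdzE pfactor_dvdn // lt0n absz_eq0.
Qed.

(** The order is compared instead of the value because 0 has valuation +oo. *)
Lemma le_gauss_val (p k : nat) (z : gaussInt) : prime p ->
  (k%:Z%:E <= gauss_val p z)%E <-> congr_mod (p ^ k)%N%:R z 0.
Proof.
move=> p_pr; rewrite gauss_congr0P /gauss_val le_min !le_padic_val //.
by split=> /andP.
Qed.

Lemma gauss_val_eq0 (p : nat) (z : gaussInt) : prime p ->
  gauss_val p z = 0%:E <-> ~ congr_mod p%:R z 0.
Proof.
move=> p_pr.
have v0 : (0%:Z%:E <= gauss_val p z)%E.
  by apply/le_gauss_val => //; exists z; rewrite subr0 mulr1.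
rewrite -{2}[p]expn1 -le_gauss_val //; case: (gauss_val p z) v0 => [v||] //=.
rewrite !lee_fin => v0; split=> [[->]//|v1]; congr (_%:E); lia.
Qed.

(** * The Gaussian power sums *)

Lemma gauss_power_sum_congr (p r : nat) : prime p -> (p = 3 %[mod 4])%N -> (0 < r)%N ->
  congr_mod p%:R (gauss_power_sum p (r * (p - 1)))
    (1 + (-1) ^+ r - (p + 1 %| r)%N%:R).
Proof.
move=> p_pr p3 r0; have p_gt1 := prime_gt1 p_pr.
have p_odd : odd p by have := divn_eq p 4; lia.
have [F [j [pF cardF j2]]] := finField_p2 p_pr p_odd.
apply/(gauss_congrP j2 _ _ pF p3); rewrite gauss_eval_power_sum //; last by nia.
rewrite subn1 dvdn_mull // mulr1 rmorphB rmorphD rmorphXn rmorphN1 rmorph1 rmorph_nat.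
have -> : j ^+ (r * p.-1) = (-1) ^+ r.
  have -> : p.-1 = (2 * (2 * (p %/ 4)).+1)%N by have := divn_eq p 4; lia.
  rewrite mulnC -mulnA exprM j2 -[LHS]signr_odd -[RHS]signr_odd.
  by rewrite oddM /= mul2n odd_double.
have -> : (p ^ 2).-1 = ((p + 1) * p.-1)%N by rewrite -mulnn; nia.
by rewrite dvdn_pmul2r //; lia.
Qed.

(** As p - 1 divides r(p-1), it divides r(p-1) - 2 only if it divides 2; this is
where p > 3 enters. *)
Lemma gauss_power_sum_cube (p r : nat) : prime p -> (p = 3 %[mod 4])%N ->
  (7 <= p)%N -> odd r ->
  congr_mod (p ^ 3)%N%:R (gauss_power_sum p (r * (p - 1))) 0.
Proof.
move=> p_pr p3 p7 r_odd.
have p_odd : odd p by have := divn_eq p 4; lia.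
have [m nE] : exists m, (r * (p - 1))%N = m.+2 by exists (r * (p - 1) - 2)%N; nia.
have m0 : (0 < m)%N by nia.
have m4 : (m = 0 %[mod 4])%N.
  have p1E : (p - 1 = 4 * (p %/ 4) + 2)%N by have := divn_eq p 4; lia.
  have -> : m = (4 * (r * (p %/ 4) + r./2))%N.
    by move: nE; rewrite p1E mulnDr mulnCA; have := odd_double_half r; lia.
  by rewrite mulnC modnMl.
rewrite nE; apply: (square_power_sum_cube sqr_gaussI p_odd m4).
have [F [j [pF cardF j2]]] := finField_p2 p_pr p_odd.
apply/(gauss_congrP j2 _ _ pF p3).
rewrite [LHS](gauss_eval_power_sum j2 pF p3 cardF m0) rmorph0.
have nd : ~~ (p.-1 %| m)%N.
  apply/negP => d; have : (p.-1 %| 2)%N.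
    by rewrite -(dvdn_addr _ d) addn2 -nE subn1 dvdn_mull.
  by move/dvdn_leq => /(_ isT); lia.
have nd2 : ~~ ((p ^ 2).-1 %| m)%N.
  apply: contra nd; apply: dvdn_trans; apply/dvdnP; exists p.+1.
  by rewrite -mulnn; nia.
by rewrite (negbTE nd) (negbTE nd2) mulr0 subr0.
Qed.

Lemma gauss_congr_nat0 (p k : nat) : (0 < k < p)%N -> ~ congr_mod p%:R (k%:R : gaussInt) 0.
Proof.
move=> /andP[k0 kp] /gauss_congr0P []; rewrite gauss_natr /= => d _.
by move: (dvdn_leq k0 d); rewrite leqNgt kp.
Qed.

Theorem theorem6 (p : nat) (p_prime : prime p) (p_mod4 : (p = 3 %[mod 4])%N) :
  (forall r : nat, (1 <= r)%N ->
    let G := gauss_power_sum p (r * (p - 1)) in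
    congr_mod p%:R G (1 + (-1) ^+ r - (p + 1)%:R * (p + 1 %| r)%N%:R)
    /\ (odd r -> congr_mod p%:R G 0)
    /\ (~~ odd r -> ~~ (p + 1 %| r)%N -> congr_mod p%:R G 2%:R)
    /\ ((p + 1 %| r)%N -> congr_mod p%:R G 1)
    /\ ((7 <= p)%N ->
          (~~ odd r -> gauss_val p G = 0%:E)
          /\ (odd r -> (3%:E <= gauss_val p G)%E)))
  /\
  (forall n : nat, (0 < n)%N -> (p - 1 %| n)%N ->
    (gauss_val p (gauss_power_sum p n) = 0%:E <-> (lcmn 4 (p - 1) %| n)%N)).
Proof.
have p_gt2 : (2 < p)%N.
  by have := prime_gt1 p_prime; have := divn_eq p 4; lia.
have p1E : (p - 1 = 2 * (2 * (p %/ 4)).+1)%N by have := divn_eq p 4; lia.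
have even_dvd r : (p + 1 %| r)%N -> ~~ odd r.
  by move=> /dvdnP[k ->]; have := divn_eq p 4; lia.
have cases r : (1 <= r)%N -> let G := gauss_power_sum p (r * (p - 1)) in
    [/\ odd r -> congr_mod p%:R G 0,
        ~~ odd r -> ~~ (p + 1 %| r)%N -> congr_mod p%:R G 2%:R &
        (p + 1 %| r)%N -> congr_mod p%:R G 1].
  move=> r0 /=; have := gauss_power_sum_congr p_prime p_mod4 r0.
  rewrite -signr_odd; case: (boolP (odd r)) => r_odd.
    have /negbTE -> : ~~ (p + 1 %| r)%N by apply: contraL r_odd => /even_dvd.
    by rewrite expr1 subrr => c; split.
  rewrite expr0; case: (p + 1 %| r)%N; first by rewrite addrK => c; split.
  by rewrite mulr0n subr0 => c; split.
(* The residues 1 and 2 are nonzero modulo p since p > 2, including for p = 3. *)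
have val0 r : (1 <= r)%N ->
    gauss_val p (gauss_power_sum p (r * (p - 1))) = 0%:E <-> ~~ odd r.
  move=> r0; rewrite gauss_val_eq0 //; have [c0 c2 c1] := cases r r0.
  split=> [nG|r_even G0]; first by apply/negP => /c0.
  have [k kp Gk] : exists2 k : nat, (0 < k < p)%N &
      congr_mod p%:R (gauss_power_sum p (r * (p - 1))) k%:R.
    case: (boolP (p + 1 %| r)%N) => d; first by exists 1%N; [lia|apply: c1].
    by exists 2%N; [lia|apply: c2].
  apply: (gauss_congr_nat0 kp).
  move: G0 Gk => [q qE] [s sE]; exists (q - s); rewrite mulrBl -qE -sE; ring.
split=> [r r0 G | n n0 /dvdnP[r nE]].
  have [c0 c2 c1] := cases r r0.
  split.
    apply: congr_mod_trans (gauss_power_sum_congr p_prime p_mod4 r0) _.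
    by exists (p + 1 %| r)%N%:R; rewrite natrD; ring.
  do 3!split=> //; move=> p7; split=> r_par; first exact/(val0 r r0).
  by apply/(@le_gauss_val p 3) => //; apply: gauss_power_sum_cube.
have r0 : (1 <= r)%N by case: r nE n0 => // ->.
rewrite nE val0 // dvdn_lcm (dvdn_mull r (dvdnn (p - 1))) andbT p1E.
rewrite mulnCA -[4%N]/(2 * 2)%N dvdn_pmul2l // Gauss_dvdl ?dvdn2 //.
by rewrite coprime2n /= mul2n odd_double.
Qed.
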